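(* There exists $n_0 \in \mathbb{N}$ such that for every integer $n \geq n_0$ and every integer $k > \frac{8 \log n}{\log\log n}$, there is no $k$-ECTF graph on $n$ vertices. That is, if $f(n)$ denotes the largest integer $k$ for which there exists a $k$-ECTF graph on $n$ vertices, then $f(n) = O\left(\frac{\log n}{\log\log n}\right)$ as $n \to \infty$.
   Context: All graphs are simple and undirected, and $\log$ is the natural logarithm. An embedding of a graph $H$ into a graph $G$ is a graph isomorphism from $H$ to an induced subgraph of $G$. A partial embedding of $H$ into $G$ is a graph isomorphism between an induced subgraph of $H$ (possibly with no vertices) and an induced subgraph of $G$. An embedding $\tilde\theta : H \to G$ extends a partial embedding $\theta$ of $H$ into $G$ if the restriction of $\tilde\theta$ to the domain of $\theta$ equals $\theta$. For a positive integer $k$, a graph $G$ is $k$-ECTF ($k$-existentially complete triangle-free) if $G$ is triangle-free and, for every triangle-free graph $H$ on $k+1$ vertices, every partial embedding of $H$ into $G$ extends to an embedding of $H$ into $G$. *)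

(* Defs.v *)
From mathcomp Require Import all_boot boolp.

Set Implicit Arguments.
Unset Strict Implicit.
Unset Printing Implicit Defensive.

Record sgraph := SGraph {
  vertex :> finType;
  adj : rel vertex;
  adj_sym : symmetric adj;
  adj_irr : irreflexive adj }.

Definition triangle_free (G : sgraph) : Prop :=
  forall x y z : G, ~ [/\ adj x y, adj y z & adj x z].

Section Induced.
Variables (G : sgraph) (A : {set G}).

Definition induced_adj : rel {x : G | x \in A} :=
  fun x y => adj (val x) (val y).

Lemma induced_adj_sym : symmetric induced_adj.
Proof. by move=> x y; rewrite /induced_adj adj_sym. Qed.

Lemma induced_adj_irr : irreflexive induced_adj.
Proof. by move=> x; rewrite /induced_adj adj_irr. Qed.

Definition induced : sgraph := SGraph induced_adj_sym induced_adj_irr.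

End Induced.

Definition graph_iso (G H : sgraph) (f : G -> H) : Prop :=
  bijective f /\ forall x y : G, adj (f x) (f y) = adj x y.

(* [f] takes its values in [G]; [g] is its corestriction to the induced
   subgraph of [G] on the image [B]. *)
Definition embedding (H G : sgraph) (f : H -> G) : Prop :=
  exists (B : {set G}) (g : H -> induced B),
    graph_iso g /\ forall x : H, f x = val (g x).

(* A partial embedding of [H] into [G] with domain [A] is an embedding of
   [induced A] into [G].  The domain is a subtype, so that the empty partial
   embedding exists even when [G] has no vertices. *)
Definition partial_embedding (H G : sgraph) (A : {set H})
    (theta : induced A -> G) : Prop :=
  embedding theta.

Definition extends (H G : sgraph) (A : {set H})
    (theta' : H -> G) (theta : induced A -> G) : Prop :=
  forall x : induced A, theta' (val x) = theta x.

Definition ECTF (k : nat) (G : sgraph) : Prop :=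
  triangle_free G /\
  forall H : sgraph, triangle_free H -> #|H| = k.+1 ->
  forall (A : {set H}) (theta : induced A -> G), partial_embedding theta ->
  exists theta' : H -> G, embedding theta' /\ extends theta' theta.

Definition has_ECTF (n k : nat) : Prop :=
  exists G : sgraph, #|G| = n /\ ECTF k G.

(* The largest positive [k] with a [k]-ECTF graph on [n] vertices, and [0] if
   there is none; the bound [k < n] is harmless, see [ECTF_lt_card] and
   [ECTF_numberP]. *)
Definition ECTF_number (n : nat) : nat :=
  \max_(k < n | (0 < k) && `[< has_ECTF n k >]) k.

Lemma embeddingP (H G : sgraph) (f : H -> G) :
  embedding f <-> injective f /\ (forall x y : H, adj (f x) (f y) = adj x y).
Proof.
split=> [[B [g [[gbij gadj] fE]]]|[finj fadj]].
  split=> [x y|x y]; rewrite !fE.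
    by move=> /val_inj; exact: (bij_inj gbij).
  exact: gadj.
have fB x : f x \in [set f y | y : H] by exact: imset_f.
exists [set f y | y : H], (fun x => exist _ (f x) (fB x)); split=> //.
split=> //.
have sur (y : induced [set f y | y : H]) : exists x, f x == val y.
  by case: y => y /= /imsetP[x _ ->]; exists x.
exists (fun y => xchoose (sur y)) => [x|y].
  by apply: finj; apply/eqP; exact: (xchooseP (sur _)).
by apply: val_inj; apply/eqP; exact: (xchooseP (sur y)).
Qed.

Lemma ECTF_lt_card (k : nat) (G : sgraph) : ECTF k G -> k < #|G|.
Proof.
case=> _ GP.
pose e : rel 'I_k.+1 := fun _ _ => false.
have es : symmetric e by [].
have ei : irreflexive e by [].
pose H := SGraph es ei.
have Htf : triangle_free H by move=> x y z [].
have emp (x : induced (set0 : {set H})) : False by case: x => x; rewrite inE.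
pose theta x : G := False_rect G (emp x).
have thetaP : partial_embedding theta.
  by apply/embeddingP; split=> x; case: (emp x).
have [|f [/embeddingP[finj _] _]] := GP H Htf _ _ _ thetaP.
  exact: card_ord.
by have := leq_card f finj; rewrite card_ord.
Qed.

Lemma ECTF_numberP (n : nat) :
  (forall k : nat, 0 < k -> has_ECTF n k -> k <= ECTF_number n) /\
  ((exists2 k : nat, 0 < k & has_ECTF n k) ->
     0 < ECTF_number n /\ has_ECTF n (ECTF_number n)).
Proof.
have ub k : 0 < k -> has_ECTF n k -> k <= ECTF_number n.
  move=> k0 hk; have kn : k < n.
    by case: (hk) => G [<- /ECTF_lt_card].
  apply: (leq_bigmax_cond (Ordinal kn) (F := fun i : 'I_n => i : nat)).
  by rewrite k0; exact/asboolP.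
split=> // -[k k0 hk].
have pos := leq_trans k0 (ub k k0 hk); split=> //.
suff : ECTF_number n = 0 \/ has_ECTF n (ECTF_number n).
  by case=> // E; rewrite E in pos.
rewrite /ECTF_number.
apply: (big_ind (fun m => m = 0 \/ has_ECTF n m)); first by left.
  by move=> x y hx hy; rewrite /maxn; case: ifP.
by move=> i /andP[_ /asboolP]; right.
Qed.

(* Main.v *)
(* Let G be a k-ECTF graph on n vertices and Y a triangle-free graph on t <= k
   vertices whose stable sets have at most (3/4)^m t vertices.  Given a stable
   set B with |B| + t <= k + 1, embed in G the disjoint union of B and a copy of
   Y.  Each common neighbour of B is adjacent to a stable set of Y, hence some
   vertex y of Y is adjacent to at most a fraction (3/4)^m of them; add y to B.
   After k - t steps B still has a common neighbour, so (4/3)^(m (k - t)) <= n.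
   An iterated blow-up gives such a Y with t = 6^m; as (4/3)^7 >= 6 this yields
   6^(m (k - 6^m)) <= n^7, and the bound follows by taking 6^m of order k / 20. *)

Require Import Defs.
From mathcomp Require Import all_boot all_order all_algebra.

(** * Stable sets and auxiliary triangle-free graphs *)

Definition stable {G : sgraph} (I : {set G}) : bool :=
  [forall x in I, forall y in I, ~~ adj x y].

Lemma stableP {G : sgraph} (I : {set G}) :
  reflect {in I &, forall x y, ~~ adj x y} (stable I).
Proof.
apply: (iffP forall_inP) => [h x y xI yI|h x xI].
  by have /forall_inP/(_ y yI) := h x xI.
by apply/forall_inP => y yI; exact: h.
Qed.

Lemma null_adj_sym (T : finType) : symmetric (fun _ _ : T => false).
Proof. by []. Qed.

Lemma null_adj_irr (T : finType) : irreflexive (fun _ _ : T => false).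
Proof. by []. Qed.

Definition null_graph (T : finType) : sgraph :=
  SGraph (@null_adj_sym T) (@null_adj_irr T).

Definition sum_adj (G H : sgraph) : rel (G + H) := fun x y =>
  match x, y with
  | inl a, inl b => adj a b
  | inr a, inr b => adj a b
  | _, _ => false
  end.

Lemma sum_adj_sym (G H : sgraph) : symmetric (sum_adj G H).
Proof. by move=> [x|x] [y|y] //=; rewrite adj_sym. Qed.

Lemma sum_adj_irr (G H : sgraph) : irreflexive (sum_adj G H).
Proof. by move=> [x|x] /=; rewrite adj_irr. Qed.

Definition sum_graph (G H : sgraph) : sgraph :=
  SGraph (@sum_adj_sym G H) (@sum_adj_irr G H).

Lemma triangle_free_sum (G H : sgraph) :
  triangle_free G -> triangle_free H -> triangle_free (sum_graph G H).
Proof.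
by move=> Gtf Htf [x|x] [y|y] [z|z] [] //= xy yz xz;
  [apply: (Gtf x y z)|apply: (Htf x y z)].
Qed.

Lemma triangle_free_induced (G : sgraph) (A : {set G}) :
  triangle_free G -> triangle_free (induced A).
Proof. by move=> Gtf x y z; exact: Gtf. Qed.

(** The star with centre [None] and leaf set [T]. *)
Definition star_adj (T : finType) : rel (option T) :=
  fun x y => isSome x (+) isSome y.

Lemma star_adj_sym (T : finType) : symmetric (@star_adj T).
Proof. by move=> x y; rewrite /star_adj addbC. Qed.

Lemma star_adj_irr (T : finType) : irreflexive (@star_adj T).
Proof. by move=> x; rewrite /star_adj addbb. Qed.

Definition star_graph (T : finType) : sgraph :=
  SGraph (@star_adj_sym T) (@star_adj_irr T).

Lemma triangle_free_star (T : finType) : triangle_free (star_graph T).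
Proof. by move=> [x|] [y|] [z|] []. Qed.

(** * Extension property and common neighbourhoods *)

(** Isolated vertices pad [H] to exactly [k.+1] vertices. Taking [f] total, with its values outside
    [A] ignored, spares later uses a map on [induced A]. *)
Lemma ECTF_extend (k : nat) (G H : sgraph) (A : {set H}) (f : H -> G) :
  ECTF k G -> triangle_free H -> #|H| <= k.+1 ->
  {in A &, injective f} -> {in A &, forall x y, adj (f x) (f y) = adj x y} ->
  exists g : H -> G, [/\ injective g,
    forall x y, adj (g x) (g y) = adj x y & {in A, g =1 f}].
Proof.
move=> GE Htf Hk finj fadj; have [_ GP] := GE.
have /card_gt0P[v0 _] : 0 < #|G| by apply: leq_trans (ECTF_lt_card GE).
pose H' := sum_graph H (null_graph 'I_(k.+1 - #|H|)).
have H'tf : triangle_free H' by apply: triangle_free_sum => // x y z [].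
have H'k : #|H'| = k.+1 by rewrite card_sum card_ord subnKC.
pose A' : {set H'} := [set inl x | x in A].
pose theta (x : induced A') := if val x is inl a then f a else v0.
have [|g [/embeddingP[ginj gadj] gE]] := GP H' H'tf H'k A' theta.
  apply/embeddingP; split.
    move=> [x xA] [y yA] /=; rewrite /theta /=.
    case/imsetP: (xA) (xA) => a aA ->; case/imsetP: (yA) (yA) => b bA -> p q e.
    by apply: val_inj; rewrite /= (finj a b).
  move=> [x xA] [y yA] /=; rewrite /theta /induced_adj /=.
  case/imsetP: xA => a aA ->; case/imsetP: yA => b bA -> /=.
  exact: fadj.
exists (fun x => g (inl x)); split.
- by move=> x y /ginj [].
- by move=> x y; rewrite gadj.
- move=> x xA; have xA' : inl x \in A' by exact: imset_f.
  exact: (gE (exist _ (inl x) xA')).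
Qed.

Definition common_nbhd {G : sgraph} (B : {set G}) : {set G} :=
  [set x | [forall b in B, adj b x]].

Lemma common_nbhdU1 (G : sgraph) (b : G) (B : {set G}) :
  common_nbhd (b |: B) = [set x in common_nbhd B | adj b x].
Proof.
apply/setP => x; rewrite !inE; apply/forall_inP/andP => [h|[/forall_inP h bx] y].
  split; last by apply: h; rewrite setU11.
  by apply/forall_inP => y yB; apply: h; rewrite setU1r.
by rewrite !inE => /orP[/eqP->|/h].
Qed.

(** Let [B] be the leaves of a star; extending this partial embedding to the centre gives a common
    neighbour. *)
Lemma common_nbhd_gt0 (k : nat) (G : sgraph) (B : {set G}) :
  ECTF k G -> stable B -> #|B| <= k -> 0 < #|common_nbhd B|.
Proof.
move=> GE /stableP Bs Bk.
have /card_gt0P[v0 _] : 0 < #|G| by apply: leq_trans (ECTF_lt_card GE).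
pose H := star_graph {x : G | x \in B}.
pose f (x : H) := if x is Some b then val b else v0.
pose A : {set H} := [set Some b | b : {x : G | x \in B}].
have [|||g [_ gadj gE]] := @ECTF_extend k G H A f GE (@triangle_free_star _).
- by rewrite card_option card_sig ltnS.
- by move=> _ _ /imsetP[x _ ->] /imsetP[y _ ->] /val_inj ->.
- move=> _ _ /imsetP[x _ ->] /imsetP[y _ ->] /=.
  by apply/negbTE/Bs; exact: valP.
apply/card_gt0P; exists (g None); rewrite inE; apply/forall_inP => b bB.
have <- : g (Some (exist _ b bB)) = b by rewrite gE // imset_f.
by rewrite gadj.
Qed.

(** * Greedy shrinking of the common neighbourhood *)

Section Shrinking.
Variables (k : nat) (G Y : sgraph) (c d : nat).
Hypotheses (GE : ECTF k G) (Ytf : triangle_free Y) (Y0 : 0 < #|Y|).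
Hypothesis Ystable : forall I : {set Y}, stable I -> c * #|I| <= d * #|Y|.

(* The neighbours of any vertex of [G] inside an induced copy of [Y] form a
   stable set; averaging over the copy yields a vertex [b] of low density. *)
Lemma common_nbhd_shrink (B : {set G}) :
  stable B -> #|B| + #|Y| <= k.+1 ->
  exists b, [/\ b \notin B, stable (b |: B) &
    c * #|common_nbhd (b |: B)| <= d * #|common_nbhd B|].
Proof.
move=> /stableP Bs BYk; have [Gtf _] := GE.
have /card_gt0P[v0 _] : 0 < #|G| by apply: leq_trans (ECTF_lt_card GE).
(* In a disjoint union no vertex of the copy of [Y] is adjacent to [B], so adding any of them to [B]
   keeps it stable. *)
pose H := sum_graph (induced B) Y.
have Htf : triangle_free H.
  by apply: triangle_free_sum => //; exact: triangle_free_induced.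
pose f (x : H) := if x is inl b then val b else v0.
pose A : {set H} := [set inl b | b : induced B].
have [|||g [ginj gadj gE]] := @ECTF_extend k G H A f GE Htf.
- by rewrite card_sum card_sig.
- by move=> _ _ /imsetP[x _ ->] /imsetP[y _ ->] /val_inj ->.
- by move=> _ _ /imsetP[x _ ->] /imsetP[y _ ->].
have gB b (bB : b \in B) : g (inl (exist _ b bB)) = b by rewrite gE // imset_f.
pose h (y : Y) : G := g (inr y).
have gBh b y : b \in B -> adj b (h y) = false.
  by move=> bB; rewrite -(gB b bB) gadj.
have [y hy] : exists y,
    c * #|[set x in common_nbhd B | adj (h y) x]| <= d * #|common_nbhd B|.
  (* If every [y] failed, double counting the edges between the copy of [Y] and the common
     neighbourhood would contradict [Ystable]; the successor in the sum keeps the inequality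
     strict. *)
  apply/existsP; apply: contraT; rewrite negb_exists => /forallP hlt.
  have : \sum_(y : Y) (d * #|common_nbhd B|).+1 <=
         \sum_(y : Y) c * #|[set x in common_nbhd B | adj (h y) x]|.
    by apply: leq_sum => y _; rewrite ltnNge.
  have -> : \sum_(y : Y) c * #|[set x in common_nbhd B | adj (h y) x]| =
            \sum_(x in common_nbhd B) c * #|[set y | adj (h y) x]|.
    rewrite -!big_distrr /=; congr (_ * _).
    under eq_bigr do rewrite -sum1_card big_mkcond /=.
    rewrite exchange_big /= [RHS]big_mkcond /=; apply: eq_bigr => x _.
    case: ifPn => xB.
      rewrite -sum1_card [RHS]big_mkcond /=; apply: eq_bigr => y _.
      by rewrite !inE; move: xB; rewrite inE => ->.
    apply: big1 => y _; rewrite !inE; move: xB; rewrite inE.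
    by move=> /negbTE ->.
  have le x : x \in common_nbhd B -> c * #|[set y | adj (h y) x]| <= d * #|Y|.
    move=> _; apply/Ystable/stableP => y z; rewrite !inE => yx zx.
    apply/negP => yz; apply: (Gtf (h y) (h z) x); split=> //.
    by rewrite /h gadj.
  move=> /leq_trans/(_ (@leq_sum _ _ _ _ _ le)).
  rewrite !sum_nat_const [leqRHS]mulnA [leqRHS]mulnC [_ * d]mulnC.
  by rewrite leq_pmul2l // ltnn.
exists (h y); split.
- apply/negP => yB.
  by have := gB _ yB => /ginj.
- apply/stableP => u v /setU1P[->|uB] /setU1P[->|vB].
  + by rewrite adj_irr.
  + by rewrite adj_sym gBh.
  + by rewrite gBh.
  + exact: Bs.
- by rewrite common_nbhdU1.
Qed.

Lemma stable_small_common_nbhd (s : nat) : s + #|Y| <= k.+1 ->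
  exists B : {set G}, [/\ stable B, #|B| = s &
    c ^ s * #|common_nbhd B| <= d ^ s * #|G|].
Proof.
elim: s => [|s IHs] sk.
  exists set0; rewrite cards0 !mul1n; split=> //; last exact: max_card.
  by apply/stableP => x y; rewrite inE.
have [|B [Bs Bc Bn]] := IHs; first exact: ltnW.
have [|b [bB bBs bBn]] := common_nbhd_shrink B Bs; first by rewrite Bc ltnW.
exists (b |: B); split=> //; first by rewrite cardsU1 bB Bc.
rewrite !expnSr -!mulnA.
apply: leq_trans (leq_mul (leqnn (c ^ s)) bBn) _.
by rewrite mulnCA [leqRHS]mulnCA leq_mul2l Bn orbT.
Qed.

Lemma ECTF_lower_bound : #|Y| <= k ->
  c ^ (k - #|Y|) <= d ^ (k - #|Y|) * #|G|.
Proof.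
move=> Yk; have [|B [Bs Bc Bn]] := stable_small_common_nbhd (k - #|Y|).
  by rewrite subnK.
apply: leq_trans Bn; apply: leq_pmulr.
by apply: (@common_nbhd_gt0 k) => //; rewrite Bc leq_subr.
Qed.

End Shrinking.

(** * Triangle-free graphs with small stable sets *)

(* The blow-up of [G] over the cycle Z_6: copies at distance at most 1 are
   joined along the edges of [G], antipodal copies by a perfect matching.  It
   multiplies the order by 6, but the independence number by at most 9/2. *)
Definition hex_near (i j : 'I_6) : bool :=
  [|| i == j, j == ordS i | i == ordS j].

Definition hex_opp (i j : 'I_6) : bool := j == ordS (ordS (ordS i)).

Definition hex_adj (G : sgraph) : rel ('I_6 * G) := fun x y =>
  (hex_near x.1 y.1 && adj x.2 y.2) || (hex_opp x.1 y.1 && (x.2 == y.2)).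

Lemma hex_near_sym : symmetric hex_near.
Proof. by move=> i j; rewrite /hex_near eq_sym; congr (_ || _); rewrite orbC. Qed.

Lemma hex_opp_sym : symmetric hex_opp.
Proof.
by case=> [[|[|[|[|[|[|]]]]]] //= ?]; case=> [[|[|[|[|[|[|]]]]]] //= ?].
Qed.

Lemma hex_opp_irr : irreflexive hex_opp.
Proof. by case=> [[|[|[|[|[|[|]]]]]] //= ?]. Qed.

Lemma hex_opp_trianglefree i j l :
  hex_opp i j -> hex_opp j l -> hex_opp i l -> False.
Proof.
by case: i => [[|[|[|[|[|[|]]]]]] //= ?];
   case: j => [[|[|[|[|[|[|]]]]]] //= ?];
   case: l => [[|[|[|[|[|[|]]]]]] //= ?].
Qed.

(** Antipodal points of the 6-cycle are at distance 3, while two near steps cover at most 2. *)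
Lemma hex_opp_not_near i j l :
  hex_opp i j -> hex_near i l -> hex_near l j -> False.
Proof.
by case: i => [[|[|[|[|[|[|]]]]]] //= ?];
   case: j => [[|[|[|[|[|[|]]]]]] //= ?];
   case: l => [[|[|[|[|[|[|]]]]]] //= ?].
Qed.

Lemma hex_adj_sym (G : sgraph) : symmetric (@hex_adj G).
Proof.
move=> x y; rewrite /hex_adj hex_near_sym hex_opp_sym adj_sym.
by rewrite [x.2 == _]eq_sym.
Qed.

Lemma hex_adj_irr (G : sgraph) : irreflexive (@hex_adj G).
Proof. by move=> x; rewrite /hex_adj adj_irr hex_opp_irr andbF. Qed.

Definition hex_graph (G : sgraph) : sgraph :=
  SGraph (@hex_adj_sym G) (@hex_adj_irr G).

(** Split by the number of matching edges in the triangle. None gives a triangle of [G]; one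
    contradicts [hex_opp_not_near]; two identify all the [G]-coordinates, making the third edge a
    loop; three contradict [hex_opp_trianglefree]. *)
Lemma triangle_free_hex (G : sgraph) :
  triangle_free G -> triangle_free (hex_graph G).
Proof.
move=> Gtf [i u] [j v] [l w] []; rewrite /= /hex_adj /=.
case/orP=> /andP[ij uv]; case/orP=> /andP[jl vw]; case/orP=> /andP[il uw].
- by apply: (Gtf u v w).
- by apply: (hex_opp_not_near i l j).
- by apply: (hex_opp_not_near j l i); rewrite // hex_near_sym.
- by rewrite (eqP uw) -(eqP vw) adj_irr in uv.
- by apply: (hex_opp_not_near i j l); rewrite // hex_near_sym.
- by rewrite -(eqP uv) (eqP uw) adj_irr in vw.
- by rewrite (eqP uv) (eqP vw) adj_irr in uw.
- exact: (hex_opp_trianglefree i j l).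
Qed.

(** If [S] has r maximal cyclic runs, the right-hand sum is |S| + r. At most one point per antipodal
    pair gives |S| <= 3 <= 3r for nonempty [S], with equality for three consecutive points. *)
Lemma hex_count (S : pred 'I_6) :
  (forall i j, hex_opp i j -> S i -> ~~ S j) ->
  4 * \sum_i S i <= 3 * \sum_i (S i || S (ordS i)).
Proof.
move=> Sopp; pose s n := S (inord n).
have SE i : S i = s i by rewrite /s inord_val.
have opp n : n < 3 -> ~~ (s n && s n.+3).
  move=> n3; apply/andP => -[sn]; apply/negP; move: sn.
  apply: Sopp; apply/eqP/val_inj => /=.
  by case: n n3 => [|[|[|]]] //= _; rewrite !inordK.
have [o0 o1 o2] := And3 (opp 0 isT) (opp 1 isT) (opp 2 isT).
under eq_bigr do rewrite SE.
under [X in _ <= 3 * X]eq_bigr do rewrite !SE.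
rewrite !big_ord_recl !big_ord0 /= /bump /=.
by move: (s 0) (s 1) (s 2) (s 3) (s 4) (s 5) o0 o1 o2 => [] [] [] [] [] [].
Qed.

(* Each [U i], the union of two consecutive slices of [I], is stable in [G]. *)
Lemma hex_stable (G : sgraph) (c d : nat) :
  (forall I : {set G}, stable I -> c * #|I| <= d * #|G|) ->
  forall I : {set hex_graph G}, stable I ->
    4 * c * #|I| <= 3 * d * #|hex_graph G|.
Proof.
move=> Gcd I /stableP Is.
pose U (i : 'I_6) : {set G} := [set u | ((i, u) \in I) || ((ordS i, u) \in I)].
have Ucd i : c * #|U i| <= d * #|G|.
  apply/Gcd/stableP => u v; rewrite !inE => uI vI; apply/negP => uv.
  have near j l : hex_near j l -> (j, u) \in I -> (l, v) \in I -> False.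
    move=> jl ju lv; have /negP[] := Is _ _ ju lv.
    by rewrite /= /hex_adj /= jl uv.
  case/orP: uI; case/orP: vI => vI uI; move: uI vI; apply: near;
  by rewrite /hex_near !eqxx ?orbT.
have IE : #|I| = \sum_u \sum_i ((i, u) \in I).
  rewrite -sum1_card big_mkcond exchange_big pair_bigA /=.
  by apply: eq_bigr => -[i u] _ /=; case: ifP.
have UE : \sum_i #|U i| = \sum_u \sum_i (((i, u) \in I) || ((ordS i, u) \in I)).
  rewrite exchange_big; apply: eq_bigr => i _.
  rewrite -sum1_card big_mkcond; apply: eq_bigr => u _.
  by rewrite inE; case: ifP.
(* Over a fixed [u], the matching edges keep antipodal copies from both lying in [I], so [hex_count]
   applies fibrewise. *)
have IU : 4 * #|I| <= 3 * \sum_i #|U i|.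
  rewrite IE UE !big_distrr /=; apply: leq_sum => u _.
  apply: (hex_count (fun i => (i, u) \in I)) => i j ij iI.
  apply/negP => jI; have /negP[] := Is _ _ iI jI.
  by rewrite /= /hex_adj /= ij eqxx orbT.
rewrite -mulnA mulnCA (leq_trans (leq_mul (leqnn c) IU)) //.
rewrite mulnCA -[leqRHS]mulnA leq_pmul2l // big_distrr /=.
rewrite card_prod mulnCA -sum_nat_const.
by apply: leq_sum => i _; exact: Ucd.
Qed.

Definition hex_tower (m : nat) : sgraph := iter m hex_graph (null_graph unit).

Lemma card_hex_tower (m : nat) : #|hex_tower m| = 6 ^ m.
Proof.
elim: m => [|m IHm]; first exact: card_unit.
by rewrite expnS -IHm -[X in X * _]card_ord -card_prod.
Qed.

Lemma triangle_free_hex_tower (m : nat) : triangle_free (hex_tower m).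
Proof.
by elim: m => [|m IHm]; [move=> x y z []|exact: triangle_free_hex].
Qed.

Lemma hex_tower_stable (m : nat) (I : {set hex_tower m}) :
  stable I -> 4 ^ m * #|I| <= 3 ^ m * #|hex_tower m|.
Proof.
elim: m I => [|m IHm] I Is; first by rewrite !mul1n max_card.
by rewrite !expnS; apply: hex_stable Is.
Qed.

Lemma ECTF_card_lower_bound (k m : nat) (G : sgraph) :
  ECTF k G -> 6 ^ m <= k -> 6 ^ (m * (k - 6 ^ m)) <= #|G| ^ 7.
Proof.
move=> GE mk; set s := k - 6 ^ m.
have bound : 4 ^ (m * s) <= 3 ^ (m * s) * #|G|.
  rewrite !expnM /s -card_hex_tower; apply: ECTF_lower_bound => //.
  - exact: triangle_free_hex_tower.
  - by rewrite card_hex_tower expn_gt0.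
  - exact: hex_tower_stable.
  - by rewrite card_hex_tower.
have pow a b p : a <= b -> a ^ p <= b ^ p by case: p => // p; rewrite leq_exp2r.
(* Raising [bound] to the seventh power replaces the base 4/3 by 6, the base of the order of the
   tower. *)
have h437 : 6 * 3 ^ 7 <= 4 ^ 7 by vm_compute.
have := pow _ _ 7 bound; rewrite expnMn (expnAC 4) (expnAC 3).
move=> /(leq_trans (pow _ _ _ h437)).
by rewrite expnMn [leqLHS]mulnC leq_pmul2l // !expn_gt0.
Qed.

(* Asymptotic estimates *)
From mathcomp Require Import all_classical all_reals all_analysis.
From mathcomp Require Import lra.
Import Order.TTheory GRing.Theory Num.Theory numFieldNormedType.Exports.
Local Open Scope classical_set_scope.
Local Open Scope ring_scope.

Lemma ECTF_upper_bound {R : realType} (n k : nat) :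
  1000 <= ln (ln (n%:R : R)) -> has_ECTF n k ->
  k%:R <= 8 * ln (n%:R : R) / ln (ln (n%:R : R)).
Proof.
set L := ln n%:R; set x := ln L => x_ge nk.
have x0 : 0 < x by lra.
(* [ln] vanishes on nonpositive reals, so a large [x] forces [L] and then [n] to be positive. *)
have L0 : 0 < L by rewrite ltNge; apply/negP => /ln0 xE; rewrite -/x in xE; lra.
have n0 : 0 < n%:R :> R.
  by rewrite ltNge; apply/negP => /ln0 LE; rewrite -/L in LE; lra.
rewrite leNgt ltr_pdivrMr //; apply/negP => kx.
have Lx : expR x = L by rewrite lnK.
(* This turns k > 8 exp(x) / x into k >= 120 exp(19x/20). The threshold 1000 makes exp(x/80) at
   least 13. *)
have x15 : 15 * x <= expR (x / 20).
  rewrite (_ : x / 20 = 4%:R * (x / 80)); last by lra.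
  rewrite expRM_natl; have := expR_ge1Dx (x / 80).
  move: (expR _) => p px; have p13 : 13 <= p by lra.
  have p2 : 13 * p <= p ^+ 2 by nra.
  have p4 : 169 * p ^+ 2 <= p ^+ 4 by rewrite (exprM p 2 2); nra.
  lra.
have k120 : 120 * expR (19 / 20 * x) <= k%:R.
  rewrite -(ler_pM2r x0); apply: le_trans (ltW kx).
  rewrite -Lx [in leRHS](_ : x = 19 / 20 * x + x / 20); last by lra.
  by rewrite expRD; have := expR_gt0 (19 / 20 * x); nra.
have k_ge : (120 <= k)%N.
  rewrite -(ler_nat R); apply: le_trans k120.
  by have := expR_ge1Dx (19 / 20 * x); lra.
have kdiv : (0 < k %/ 20)%N by rewrite divn_gt0 // (leq_trans _ k_ge).
(* Then 6^m lies between k/120 and k/20: small enough that s >= 19k/20, large enough that 6^m >=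
   exp(19x/20). *)
have /andP[m_le m_gt] := trunc_log_bounds (isT : (1 < 6)%N) kdiv.
move: m_le m_gt; set m := trunc_log 6 _ => m_le m_gt.
have mk : (20 * 6 ^ m <= k)%N by rewrite mulnC -leq_divRL.
have km : (k < 120 * 6 ^ m)%N.
  by move: m_gt; rewrite ltn_divLR // expnS mulnC mulnA.
have mk' : (6 ^ m <= k)%N by apply: leq_trans mk; rewrite leq_pmull.
pose s := (k - 6 ^ m)%N.
have sk : 19 / 20 * k%:R <= s%:R :> R.
  rewrite /s natrB //; move: mk; rewrite -(ler_nat R) natrM; lra.
have em : expR (19 / 20 * x) <= (6 ^ m)%:R.
  by move: km; rewrite -(ltr_nat R) natrM; lra.
case: nk => G [Gn GE].
have := ECTF_card_lower_bound k m G GE mk'; rewrite Gn => nE.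
have : expR (s%:R * (19 / 20 * x)) <= expR (7 * L).
  rewrite (expRM_natl s) (expRM_natl 7).
  apply: (@le_trans _ _ ((6 ^ m)%:R ^+ s)).
    by apply: lerXn2r; rewrite ?nnegrE ?expR_ge0 ?ler0n.
  by rewrite lnK // -!natrX ler_nat -expnM.
(* The contradiction is numerical: 8 (19/20)^2 = 7.22 exceeds 7. *)
have sx : 19 / 20 * (k%:R * x) <= s%:R * x by rewrite mulrA ler_wpM2r // ltW.
rewrite ler_expR mulrCA; move: sx kx L0.
by move: (k%:R * x) (s%:R * x) => p q pq Lp L0 qL; lra.
Qed.

Theorem theorem1 (R : realType) :
  (exists n0 : nat, forall n k : nat, (n0 <= n)%N ->
     8 * ln (n%:R : R) / ln (ln (n%:R : R)) < k%:R ->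
     ~ exists G : sgraph, #|G| = n /\ ECTF k G) /\
  (fun n : nat => (ECTF_number n)%:R : R^o) =O_\oo
    (fun n : nat => ln (n%:R : R) / ln (ln (n%:R : R)) : R^o).
Proof.
have large : \forall n \near \oo, 1000 <= ln (ln (n%:R : R)).
  near=> n.
  have nE : expR (expR 1000) <= n%:R :> R by near: n; exact: nbhs_infty_ger.
  have n0 : 0 < n%:R :> R := lt_le_trans (expR_gt0 _) nE.
  have LE : expR 1000 <= ln (n%:R : R) by rewrite -ler_expR lnK.
  have L0 : 0 < ln (n%:R : R) := lt_le_trans (expR_gt0 _) LE.
  by rewrite -ler_expR lnK.
split.
  case: large => n0 _ large; exists n0 => n k n0n kn GE.
  by have := ECTF_upper_bound n k (large n n0n) GE; rewrite leNgt kn.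
apply/eqO_exP; exists 8 => //; near=> n.
have n_large : 1000 <= ln (ln (n%:R : R)) by near: n; exact: large.
have [hn|no] := pselect (exists2 k : nat, (0 < k)%N & has_ECTF n k).
  have [_ /(_ hn) [_ /(ECTF_upper_bound _ _ n_large) le8]] := ECTF_numberP n.
  rewrite ger0_norm ?ler0n //; apply: le_trans le8 _.
  by rewrite -mulrA ler_pM2l // ler_norm.
have -> : ECTF_number n = 0%N.
  apply: big_pred0 => k; apply/negP => /andP[k0 /asboolP hk].
  by apply: no; exists (k : nat).
by rewrite normr0 mulr_ge0.
Unshelve. all: by end_near.
Qed.
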